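(* Let $V$ be an absolute order unit space and let $u, v \in V^+$ with $u \perp_{\infty}^a v$. Then $u \perp_{\infty}^e v$.
   Context: An order unit space $(V,e)$ is a real ordered vector space $V$ with proper positive cone $V^+$ (where $x \le y$ means $y - x \in V^+$), with an order unit $e \in V^+$, $e\neq 0$ (for every $v \in V$ there is $k>0$ with $ke \pm v \in V^+$), such that $V^+$ is Archimedean; it carries the order unit norm $\|v\| = \inf\{k > 0 : ke \pm v \in V^+\}$, in which $V^+$ is closed. Order intervals are $[a,b] = \{v \in V : a \le v \le b\}$. For elements $x, y$ of a real normed linear space, $x \perp_{\infty} y$ means $\|x + k y\| = \max\{\|x\|, \|k y\|\}$ for all $k \in \mathbb{R}$. For subsets $A,B$, $A \perp_{\infty} B$ means $a \perp_\infty b$ for all $a \in A$, $b \in B$. For $u,v \in V^+$: $u \perp_{\infty}^a v$ (absolutely $\infty$-orthogonal) means $[0,u] \perp_\infty [0,v]$; $u \perp_{\infty}^e v$ (extensively $\infty$-orthogonal) means $[-u,u] \perp_\infty [-v,v]$. Absolutely ordered space: a real ordered vector space $(V, V^+)$ with a map $|\cdot| : V \to V^+$ such that (a) $|v| = v$ if $v \in V^+$; (b) $|v| \pm v \in V^+$ for all $v \in V$; (c) $|kv| = |k|\,|v|$ for all $v \in V$, $k \in \mathbb{R}$; (d) if $u, v, w \in V$ with $|u - v| = u + v$ and $0 \le w \le v$, then $|u - w| = u + w$; (e) if $u, v, w \in V$ with $|u - v| = u + v$ and $|u - w| = u + w$, then $\bigl|u - |v \pm w|\bigr| = u + |v \pm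 w|$ (for both signs). In such a space, for $u,v \in V^+$, write $u \perp v$ if $|u - v| = u + v$. Absolute order unit space: an order unit space $(V,e)$ that is also an absolutely ordered space $(V,V^+,|\cdot|)$ (same cone) and in which, for all $u,v \in V^+$, $u \perp v$ if and only if $u \perp_\infty^a v$. *)

(* Defs.v *)
From mathcomp Require Import all_boot all_order all_algebra.
From mathcomp Require Import all_classical all_reals.

Set Implicit Arguments.
Unset Strict Implicit.
Unset Printing Implicit Defensive.

Import Order.TTheory GRing.Theory Num.Theory.
Local Open Scope classical_set_scope.
Local Open Scope ring_scope.

Section OrderedSpaces.
Context {R : realType} {V : lmodType R}.
Implicit Types (pos : set V) (e u v w x y : V) (abs : V -> V) (N : V -> R).

Record ordered_vector_space pos : Prop := OrderedVectorSpace {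
  cone0 : pos 0;
  coneD : forall u v, pos u -> pos v -> pos (u + v);
  coneZ : forall (k : R) v, 0 <= k -> pos v -> pos (k *: v) }.

Definition proper_cone pos : Prop := forall v, pos v -> pos (- v) -> v = 0.

Definition archimedean_cone pos : Prop :=
  forall u v, pos u -> (forall k : R, 0 < k -> pos (k *: u + v)) -> pos v.

Definition cone_le pos x y : Prop := pos (y - x).

Definition order_interval pos x y : set V :=
  [set v | cone_le pos x v /\ cone_le pos v y].

Definition order_unit pos e : Prop :=
  [/\ pos e, e != 0 &
      forall v, exists k : R, [/\ 0 < k, pos (k *: e + v) & pos (k *: e - v)]].

Record order_unit_space pos e : Prop := OrderUnitSpace {
  ous_ordered : ordered_vector_space pos;
  ous_proper : proper_cone pos;
  ous_unit : order_unit pos e;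
  ous_archimedean : archimedean_cone pos }.

Definition order_unit_norm pos e v : R :=
  inf [set k : R | [/\ 0 < k, pos (k *: e + v) & pos (k *: e - v)]].

Definition inf_orthogonal N x y : Prop :=
  forall k : R, N (x + k *: y) = Num.max (N x) (N (k *: y)).

Definition inf_orthogonal_sets N (A B : set V) : Prop :=
  forall a b, A a -> B b -> inf_orthogonal N a b.

(* Both notions below are only meant for [u] and [v] in the cone. *)
Definition abs_inf_orthogonal pos e u v : Prop :=
  inf_orthogonal_sets (order_unit_norm pos e)
    (order_interval pos 0 u) (order_interval pos 0 v).

Definition ext_inf_orthogonal pos e u v : Prop :=
  inf_orthogonal_sets (order_unit_norm pos e)
    (order_interval pos (- u) u) (order_interval pos (- v) v).

(* The modulus, a map from the space to its cone, is a function [V -> V]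
   together with the field [abs_pos]. *)
Record absolutely_ordered_space pos abs : Prop := AbsolutelyOrderedSpace {
  aos_ordered : ordered_vector_space pos;
  abs_pos : forall v, pos (abs v);
  abs_id : forall v, pos v -> abs v = v;
  abs_dom : forall v, pos (abs v + v) /\ pos (abs v - v);
  absZ : forall (k : R) v, abs (k *: v) = `|k| *: abs v;
  abs_orth_le : forall u v w, abs (u - v) = u + v ->
    cone_le pos 0 w -> cone_le pos w v -> abs (u - w) = u + w;
  abs_orth_abs : forall u v w, abs (u - v) = u + v -> abs (u - w) = u + w ->
    abs (u - abs (v + w)) = u + abs (v + w) /\
    abs (u - abs (v - w)) = u + abs (v - w) }.

Definition orthogonal abs u v : Prop := abs (u - v) = u + v.

Record absolute_order_unit_space pos e abs : Prop := AbsoluteOrderUnitSpace {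
  aous_ous : order_unit_space pos e;
  aous_aos : absolutely_ordered_space pos abs;
  aous_orthogonal : forall u v, pos u -> pos v ->
    (orthogonal abs u v <-> abs_inf_orthogonal pos e u v) }.

End OrderedSpaces.

(* Main.v *)
Require Import Defs.
From mathcomp Require Import all_boot all_order all_algebra.
From mathcomp Require Import all_classical all_reals.

(** Take [x] in [[-u, u]] and [y] in [[-v, v]].  It is tempting to bound [abs x]
by [u] and use the hypothesis on [[0, u]] and [[0, v]], but [abs x <= u]
can fail, for instance in the self-adjoint part of a noncommutative C*-algebra.
What survives is orthogonality: [x] is a difference of two
elements of [[0, u]], so the axioms on the modulus turn [u] orthogonal to [v]
into [abs x] orthogonal to [abs y] ([orthogonal_abs_between], used on each
side).

The modulus then reduces everything to the cone.  The positive and negative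
parts of [x] and [y] are pairwise orthogonal, hence [abs (x + y) = abs x + abs y]
([abs_add_orthogonal]).  Moreover [x] and [abs x] are the difference and the sum
of the same two orthogonal positive elements, and infinity-orthogonality gives
both the same norm ([norm_abs]).  The norm of [x + y] is therefore that of
[abs x + abs y], which is the maximum of the two norms because orthogonal
positive elements are infinity-orthogonal.  The scalar [k] in the definition of
infinity-orthogonality is absorbed into [y], at the price of replacing [v] by
[`|k| *: v] ([orthogonal_scale]). *)

Set Implicit Arguments.
Unset Strict Implicit.
Unset Printing Implicit Defensive.

Import Order.TTheory GRing.Theory Num.Theory.
Local Open Scope classical_set_scope.
Local Open Scope ring_scope.

Section Cone.
Context {R : realType} {V : lmodType R} (pos : set V).

(** For [u = abs x] these are the positive and negative parts of [x]; for
arbitrary [u] they are the halves of [u + x] and [u - x]. *)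
Lemma between_split (u x : V) : ordered_vector_space pos ->
  pos (u + x) -> pos (u - x) ->
  exists a b, [/\ pos a, pos b, u = a + b & x = a - b].
Proof.
move=> hO hp hm.
have h0 : (0 : R) <= 2^-1 by rewrite invr_ge0.
exists (2^-1 *: (u + x)), (2^-1 *: (u - x)); split; try exact: coneZ.
- by rewrite -scalerDr addrACA subrr addr0 -mulr2n -scaler_nat scalerA mulVf
    ?scale1r ?pnatr_eq0.
- by rewrite -scalerBr opprB [x - u]addrC addrACA subrr add0r -mulr2n
    -scaler_nat scalerA mulVf ?scale1r ?pnatr_eq0.
Qed.

Lemma order_unit_normN (e v : V) :
  order_unit_norm pos e (- v) = order_unit_norm pos e v.
Proof.
congr (inf _); apply/seteqP; split=> k /= []; rewrite opprK; by split.
Qed.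

Lemma between_scale (k : R) (v y : V) : ordered_vector_space pos ->
  pos (v + y) -> pos (v - y) ->
  pos (`|k| *: v + k *: y) /\ pos (`|k| *: v - k *: y).
Proof.
move=> hO hp hm.
have [k0|k0] := leP 0 k.
  by rewrite ger0_norm // -scalerDr -scalerBr; split; apply: coneZ.
have k1 : 0 <= - k by rewrite oppr_ge0 ltW.
have -> : k *: y = - (- k *: y) by rewrite scaleNr opprK.
by rewrite ltr0_norm // opprK -scalerDr -scalerBr; split; apply: coneZ.
Qed.

End Cone.

Section Orthogonality.
Context {R : realType} {V : lmodType R} (pos : set V) (abs : V -> V).
Context (hA : absolutely_ordered_space pos abs).

Local Notation "u _|_ v" := (Defs.orthogonal abs u v) (at level 70).

Lemma orthogonal_sym u v : u _|_ v -> v _|_ u.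
Proof.
rewrite /Defs.orthogonal => h.
by rewrite -opprB -scaleN1r (absZ hA) normrN1 scale1r h addrC.
Qed.

Lemma orthogonal_addr_inv u v w : pos v -> pos w -> u _|_ (v + w) ->
  (u _|_ v) /\ (u _|_ w).
Proof.
move=> hv hw h.
split; apply: (abs_orth_le hA h); rewrite /cone_le ?subr0 //.
  by rewrite [v + w]addrC addrK.
by rewrite addrK.
Qed.

Lemma orthogonal_add u v w : pos v -> pos w -> u _|_ v -> u _|_ w ->
  u _|_ (v + w).
Proof.
move=> hv hw h1 h2; have [h _] := abs_orth_abs hA h1 h2.
by rewrite (abs_id hA (coneD (aos_ordered hA) hv hw)) in h.
Qed.

(** Stands in for [abs y <= v], which can fail: [y] is a difference of two
elements of [[0, v]], both orthogonal to [u], and orthogonality to [u] passes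
to the modulus of a difference. *)
Lemma orthogonal_abs_between u v y : pos (v + y) -> pos (v - y) -> u _|_ v ->
  u _|_ abs y.
Proof.
move=> hp hm huv.
have [a [b [ha hb ev ->]]] := between_split (aos_ordered hA) hp hm.
have [h1 h2] : (u _|_ a) /\ (u _|_ b).
  by apply: orthogonal_addr_inv => //; rewrite -ev.
by have [] := abs_orth_abs hA h1 h2.
Qed.

(** The positive and negative parts are orthogonal because their difference
and their sum are [x] and [abs x]. *)
Lemma orthogonal_decomposition x :
  exists a b, [/\ pos a, pos b, a _|_ b, abs x = a + b & x = a - b].
Proof.
have [hp hm] := abs_dom hA x.
have [a [b [ha hb e1 e2]]] := between_split (aos_ordered hA) hp hm.
by exists a, b; split=> //; rewrite /Defs.orthogonal -e1 -e2.
Qed.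

(** The sum of the positive parts is orthogonal to the sum of the negative
parts, so these sums are the two parts of [x + y]. *)
Lemma abs_add_orthogonal x y : abs x _|_ abs y -> abs (x + y) = abs x + abs y.
Proof.
have [a [b [ha hb hab -> ->]]] := orthogonal_decomposition x.
have [c [d [hc hd hcd -> ->]]] := orthogonal_decomposition y.
move=> h.
have [hx_c hx_d] := orthogonal_addr_inv hc hd h.
have [_ hcb] := orthogonal_addr_inv ha hb (orthogonal_sym hx_c).
have [hda _] := orthogonal_addr_inv ha hb (orthogonal_sym hx_d).
have h1 : (b + d) _|_ a.
  by apply: orthogonal_sym; apply: orthogonal_add => //; apply: orthogonal_sym.
have h2 : (b + d) _|_ c by apply: orthogonal_sym; apply: orthogonal_add.
have h3 := orthogonal_sym (orthogonal_add ha hc h1 h2).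
by rewrite addrACA -opprD [RHS]addrACA.
Qed.

End Orthogonality.

Section Norm.
Context {R : realType} {V : lmodType R} (pos : set V) (e : V) (abs : V -> V).
Context (hV : absolute_order_unit_space pos e abs).

Local Notation "u _|_ v" := (Defs.orthogonal abs u v) (at level 70).
Local Notation N := (order_unit_norm pos e).

Lemma orthogonal_inf_orthogonal u v : pos u -> pos v -> u _|_ v ->
  inf_orthogonal N u v.
Proof.
move=> hu hv /(aous_orthogonal hV hu hv); apply.
all: rewrite /order_interval /cone_le /= subr0 subrr; split=> //.
all: exact: cone0 (aos_ordered (aous_aos hV)).
Qed.

(** Changing the sign of the second of two infinity-orthogonal elements does
not change the norm of the sum. *)
Lemma norm_abs x : N (abs x) = N x.
Proof.
have [a [b [ha hb hab -> ->]]] := orthogonal_decomposition (aous_aos hV) x.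
have h := orthogonal_inf_orthogonal ha hb hab.
have := h (-1); have := h 1.
by rewrite scale1r scaleN1r order_unit_normN => -> ->.
Qed.

(** Homogeneity is read off on the side of infinity-orthogonality, where a
factor of the second element merges with the scalar quantified in its
definition. *)
Lemma orthogonal_scale (k : R) u v : 0 <= k -> pos u -> pos v -> u _|_ v ->
  u _|_ (k *: v).
Proof.
move=> k0 hu hv huv; have hA := aous_aos hV; have hO := aos_ordered hA.
have [->|kn0] := eqVneq k 0.
  by rewrite scale0r /Defs.orthogonal subr0 addr0 (abs_id hA).
apply/(aous_orthogonal hV hu (coneZ hO k0 hv)) => a b ha [].
rewrite /cone_le subr0 => hb hbv m.
have -> : b = k *: (k^-1 *: b) by rewrite scalerA mulfV // scale1r.
rewrite scalerA; apply: ((aous_orthogonal hV hu hv).1 huv) => //.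
have k1 : 0 <= k^-1 by rewrite invr_ge0.
rewrite /order_interval /cone_le /= subr0; split; first exact: coneZ.
have -> : v - k^-1 *: b = k^-1 *: (k *: v - b).
  by rewrite scalerBr scalerA mulVf // scale1r.
exact: coneZ.
Qed.

End Norm.

Theorem theorem3p2 (R : realType) (V : lmodType R)
    (pos : set V) (e : V) (abs : V -> V)
    (hV : absolute_order_unit_space pos e abs)
    (u v : V) (hu : pos u) (hv : pos v)
    (huv : abs_inf_orthogonal pos e u v) :
  ext_inf_orthogonal pos e u v.
Proof.
have hA := aous_aos hV.
move=> x y []; rewrite /cone_le opprK addrC => hxp hxm [].
rewrite /cone_le opprK addrC => hyp hym k.
have [hkp hkm] := between_scale k (aos_ordered hA) hyp hym.
have huv' : Defs.orthogonal abs u (`|k| *: v).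
  by apply: (orthogonal_scale hV) => //; apply/(aous_orthogonal hV hu hv).
have hux := orthogonal_sym hA (orthogonal_abs_between hA hkp hkm huv').
have hxy := orthogonal_sym hA (orthogonal_abs_between hA hxp hxm hux).
have := orthogonal_inf_orthogonal hV (abs_pos hA x) (abs_pos hA (k *: y)) hxy 1.
by rewrite scale1r -(abs_add_orthogonal hA hxy) !(norm_abs hV).
Qed.
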